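(* Let $P\subset\mathbb{R}^d$ be the cube $[-1,1]^d$. The bisection fan of $P$ exists and is equal to the common refinement of the fan $\mathcal{H}$ induced by the coordinate hyperplanes $\{x\in\mathbb{R}^d:x_i=0\}$, $i=1,\dots,d$, and the face fan $\mathcal{F}_P$ of $P$.
   Context: For $P=[-1,1]^d$ the distance function is $\operatorname{dist}(a,b)=\|b-a\|_\infty$. The bisector is $\operatorname{bis}(a,b)=\{x\in\mathbb{R}^d:\|x-a\|_\infty=\|x-b\|_\infty\}$. For a face $F$ of $P$, $C_F=\operatorname{cone}(F)$ is the set of all finite nonnegative linear combinations of points of $F$; the face fan is $\mathcal{F}_P=\{C_F:F\subsetneq P\text{ a face}\}$. For facets $F,G$, $\operatorname{bis}_{F,G}(a,b)=\operatorname{bis}(a,b)\cap(C_F+a)\cap(C_G+b)$. Two bisectors $\operatorname{bis}(a,b)$ and $\operatorname{bis}(a',b')$ are equivalent if for all facets $F,G$ of $P$: $\operatorname{bis}_{F,G}(a,b)\ne\emptyset \Leftrightarrow \operatorname{bis}_{F,G}(a',b')\neq\emptyset$. A point $c\in\mathbb{R}^d$ is in general position if there is a neighborhood $U$ of $c$ such that $\operatorname{bis}(0,c)$ is equivalent to $\operatorname{bis}(0,c')$ for all $c'\in U$. A polyhedral fan $\Delta$ is the bisection fan of $P$ if for all $a,b\in\mathbb{R}^d$ in general position the following are equivalent: (i) $\operatorname{bis}(0,a)$ and $\operatorname{bis}(0,b)$ are equivalent; (ii) $a$ and $b$ lie in the interior of the same maximal cone of $\Delta$. The common refinement of two fans consists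 of all intersections of a cone of one with a cone of the other. *)

(* Defs.v *)
From HB Require Import structures.
From mathcomp Require Import all_boot all_order all_algebra.
From mathcomp Require Import all_classical all_reals all_analysis.
Import Order.TTheory GRing.Theory Num.Theory numFieldNormedType.Exports.

Set Implicit Arguments.
Unset Strict Implicit.
Unset Printing Implicit Defensive.

Local Open Scope classical_set_scope.
Local Open Scope ring_scope.

Definition dotv (R : realType) (d : nat) (u x : 'rV[R]_d) : R :=
  \sum_(i < d) u 0 i * x 0 i.

Definition inclusion_maximal (T : Type) (X : set (set T)) (A : set T) : Prop :=
  X A /\ forall B, X B -> A `<=` B -> B = A.

(* Faces are cut out by valid inequalities; u = 0 with c = 0, resp. c = 1,
   makes A itself, resp. the empty set, a face of A. *)
Definition face (R : realType) (d : nat) (A F : set 'rV[R]_d) : Prop :=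
  exists (u : 'rV[R]_d) (c : R),
    (forall x, A x -> dotv u x <= c) /\ F = A `&` [set x | dotv u x = c].

Definition proper_face (R : realType) (d : nat) (A F : set 'rV[R]_d) : Prop :=
  face A F /\ F `<` A.

Definition facet (R : realType) (d : nat) (A F : set 'rV[R]_d) : Prop :=
  inclusion_maximal (proper_face A) F.

(* n = 0 is allowed, so that cone set0 = [set 0]. *)
Definition cone (R : realType) (d : nat) (A : set 'rV[R]_d) : set 'rV[R]_d :=
  [set x | exists (n : nat) (l : 'I_n -> R) (v : 'I_n -> 'rV[R]_d),
     [/\ forall k, 0 <= l k, forall k, A (v k) & x = \sum_(k < n) l k *: v k]].

Definition polyhedral_cone (R : realType) (d : nat) (C : set 'rV[R]_d) : Prop :=
  exists (n : nat) (u : 'I_n -> 'rV[R]_d),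
    C = [set x | forall k, 0 <= dotv (u k) x].

Definition polyhedral_fan (R : realType) (d : nat)
    (D : set (set 'rV[R]_d)) : Prop :=
  [/\ finite_set D,
      forall C, D C -> polyhedral_cone C,
      forall C F, D C -> face C F -> F !=set0 -> D F &
      forall C C', D C -> D C' -> face C (C `&` C') /\ face C' (C `&` C')].

Definition common_refinement (R : realType) (d : nat)
    (D E : set (set 'rV[R]_d)) : set (set 'rV[R]_d) :=
  [set C `&` C' | C in D & C' in E].

Definition face_fan (R : realType) (d : nat)
    (P : set 'rV[R]_d) : set (set 'rV[R]_d) :=
  [set cone F | F in proper_face P].

(* The closed cells of the arrangement of the linear hyperplanes with normals
   u k.  The cell attached to the sign vector of y takes, for each k, the
   hyperplane itself if y lies on it, and otherwise the closed halfspace that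
   contains y. *)
Definition arrangement_fan (R : realType) (d n : nat)
    (u : 'I_n -> 'rV[R]_d) : set (set 'rV[R]_d) :=
  [set [set x | forall k, Num.sg (dotv (u k) x) = 0 \/
                          Num.sg (dotv (u k) x) = Num.sg (dotv (u k) y)]
  | y in [set: 'rV[R]_d]].

Definition coordinate_fan (R : realType) (d : nat) : set (set 'rV[R]_d) :=
  arrangement_fan (fun i : 'I_d => delta_mx 0 i : 'rV[R]_d).

Definition cube (R : realType) (d : nat) : set 'rV[R]_d :=
  [set x | forall i, -1 <= x 0 i <= 1].

(* The norm of the library on 'rV[R]_d is the maximum norm. *)
Definition bisector (R : realType) (d : nat)
    (a b : 'rV[R]_d) : set 'rV[R]_d :=
  [set x | `|x - a| = `|x - b|].

Definition bisector_part (R : realType) (d : nat)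
    (F G : set 'rV[R]_d) (a b : 'rV[R]_d) : set 'rV[R]_d :=
  bisector a b `&` [set y + a | y in cone F] `&` [set y + b | y in cone G].

Definition bisector_equiv (R : realType) (d : nat)
    (a b a' b' : 'rV[R]_d) : Prop :=
  forall F G, facet (@cube R d) F -> facet (@cube R d) G ->
    (bisector_part F G a b !=set0 <-> bisector_part F G a' b' !=set0).

Definition general_position (R : realType) (d : nat) (c : 'rV[R]_d) : Prop :=
  \forall c' \near nbhs c, bisector_equiv 0 c 0 c'.

Definition is_cube_bisection_fan (R : realType) (d : nat)
    (D : set (set 'rV[R]_d)) : Prop :=
  polyhedral_fan D /\
  forall a b : 'rV[R]_d, general_position a -> general_position b ->
    (bisector_equiv 0 a 0 b <->
     exists C, [/\ inclusion_maximal D C, interior C a & interior C b]).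

(* Main.v *)
Require Import Defs.
From mathcomp Require Import all_boot all_order all_algebra.
From mathcomp Require Import all_classical all_reals all_analysis.
From mathcomp Require Import lra.
Import Order.TTheory GRing.Theory Num.Theory numFieldNormedType.Exports.

(* For the facets F = {s x_i = 1} and G = {t x_j = 1} of the cube, with s and t
   signs, bis_{F,G}(0,c) is nonempty iff c_i = 0 (if F = G), iff
   ||c|| <= s c_i (if G = -F), and iff s c_i >= 0 >= t c_j (if i <> j).  Hence c
   is in general position iff its coordinates are nonzero and ||c|| is attained
   at a single coordinate, and for such c the bisector records exactly the signs
   of c and the position of its largest coordinate.

   The refinement of the two fans consists of the sets [cell y] of all x whose
   nonzero coordinates have the signs of those of y and whose norm is attained
   wherever the norm of y is.  The cells of the points in general position are
   its maximal cones.

   For uniqueness, let C be a maximal cone of a bisection fan with a in its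
   interior, a in general position.  For x in C and b generic in the interior of
   [cell a], the points x + t b with small t > 0 are in general position and
   interior to C, hence in [cell a]; letting t tend to 0 gives C = [cell a].  So
   the fan contains all cells, and since they cover the space, each of its cones
   C has a relatively interior point in some maximal cell, which makes C a face
   of that cell. *)

Set Implicit Arguments.
Unset Strict Implicit.
Unset Printing Implicit Defensive.

Local Open Scope classical_set_scope.
Local Open Scope ring_scope.

(** * Linear functionals and the maximum norm in coordinates *)

Lemma dotvD (R : realType) d (u x y : 'rV[R]_d) :
  dotv u (x + y) = dotv u x + dotv u y.
Proof.
by rewrite /dotv -big_split; apply: eq_bigr => i _; rewrite mxE mulrDr.
Qed.

Lemma dotvZ (R : realType) d (u x : 'rV[R]_d) (a : R) :
  dotv u (a *: x) = a * dotv u x.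
Proof.
by rewrite /dotv mulr_sumr; apply: eq_bigr => i _; rewrite mxE mulrCA.
Qed.

Lemma dotv0 (R : realType) d (u : 'rV[R]_d) : dotv u 0 = 0.
Proof. by rewrite -(scale0r 0) dotvZ mul0r. Qed.

Lemma dotvB (R : realType) d (u x y : 'rV[R]_d) :
  dotv u (x - y) = dotv u x - dotv u y.
Proof. by rewrite dotvD -scaleN1r dotvZ mulN1r. Qed.

Lemma dotv_sum (R : realType) d n (u : 'rV[R]_d) (v : 'I_n -> 'rV[R]_d) :
  dotv u (\sum_k v k) = \sum_k dotv u (v k).
Proof.
by elim/big_rec2: _ => [|k y1 y2 _ <-]; rewrite ?dotv0 // dotvD.
Qed.

Lemma dotvDl (R : realType) d (u v x : 'rV[R]_d) :
  dotv (u + v) x = dotv u x + dotv v x.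
Proof.
by rewrite /dotv -big_split; apply: eq_bigr => i _; rewrite mxE mulrDl.
Qed.

Lemma dotvZl (R : realType) d (u x : 'rV[R]_d) (a : R) :
  dotv (a *: u) x = a * dotv u x.
Proof.
by rewrite /dotv mulr_sumr; apply: eq_bigr => i _; rewrite mxE mulrA.
Qed.

Lemma dotv0l (R : realType) d (x : 'rV[R]_d) : dotv 0 x = 0.
Proof. by rewrite /dotv big1 // => i _; rewrite mxE mul0r. Qed.

Lemma dotv_delta (R : realType) d (i : 'I_d) (x : 'rV[R]_d) :
  dotv (delta_mx 0 i) x = x 0 i.
Proof.
rewrite /dotv (bigD1 i) //= mxE !eqxx mul1r big1 ?addr0 // => j ji.
by rewrite mxE (negbTE ji) andbF mul0r.
Qed.

Lemma ord_dim_gt0 d (i : 'I_d) : (0 < d)%N.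
Proof. exact: leq_ltn_trans (leq0n i) (ltn_ord i). Qed.

Lemma coord_le_norm (R : realType) d (x : 'rV[R]_d) i : `|x 0 i| <= `|x|.
Proof.
rewrite [leRHS]/Num.norm /= mx_normrE.
by apply: (le_bigmax _ (fun p : 'I_1 * 'I_d => `|x p.1 p.2|) (0, i)).
Qed.

Lemma norm_row_le (R : realType) d (x : 'rV[R]_d) (r : R) :
  0 <= r -> (forall i, `|x 0 i| <= r) -> `|x| <= r.
Proof.
move=> r0 h; rewrite [leLHS]/Num.norm /= mx_normrE.
by apply: bigmax_le => // -[j k] _ /=; rewrite ord1.
Qed.

Lemma norm_row_attained (R : realType) d (x : 'rV[R]_d) :
  (0 < d)%N -> exists i, `|x| = `|x 0 i|.
Proof.
move=> d0; have [x0|x0] := eqVneq `|x| 0.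
  exists (Ordinal d0); rewrite x0; apply/eqP; rewrite eq_sym -normr_le0.
  by rewrite normr_id -x0 coord_le_norm.
have [[j i] /= xi] := mx_norm_neq0 (x0 : mx_norm x != 0); exists i.
by rewrite [LHS]/Num.norm /= xi ord1.
Qed.

(** Turns the sign condition of [arrangement_fan] into an equation whose left side is linear in
    [x]. *)
Lemma sg_mul_norm_iff (R : realType) (x y : R) :
  (Num.sg x = 0 \/ Num.sg x = Num.sg y) <-> Num.sg y * x = `|x|.
Proof.
split=> [[/eqP|<-]|].
- by rewrite sgr_eq0 => /eqP ->; rewrite mulr0 normr0.
- by rewrite -normrEsg.
have [->|x0] := eqVneq x 0; first by rewrite sgr0; left.
by rewrite normrEsg => /(mulIf x0) ->; right.
Qed.

Lemma sg_mul_norm_eq (R : realType) (x y : R) :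
  x != 0 -> Num.sg y * x = `|x| -> Num.sg y = Num.sg x.
Proof. by move=> x0; rewrite normrEsg => /(mulIf x0). Qed.

Lemma sg_mul_le_norm (R : realType) (x y : R) : Num.sg y * x <= `|x|.
Proof.
apply: le_trans (ler_norm _) _; rewrite normrM normr_sg.
by case: (y != 0); rewrite ?mul1r ?mul0r.
Qed.

(** * Cells and their relative interiors *)

Definition signs_agree (R : realType) d (y x : 'rV[R]_d) : Prop :=
  forall k, Num.sg (y 0 k) * x 0 k = `|x 0 k|.

(** By [coord_le_norm], the inequality |y| <= |y_k| says that the norm of [y] is attained at [k]. *)
Definition cell (R : realType) d (y : 'rV[R]_d) : set 'rV[R]_d :=
  [set x | signs_agree y x /\ forall k, `|y| <= `|y 0 k| -> `|x| <= `|x 0 k|].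

Lemma signs_agree_normD (R : realType) d (y x w : 'rV[R]_d) k :
  signs_agree y x -> signs_agree y w ->
  `|(x + w) 0 k| = `|x 0 k| + `|w 0 k|.
Proof.
move=> yx yw; apply/eqP; rewrite eq_le mxE ler_normD /=.
by rewrite -yx -yw -mulrDr sg_mul_le_norm.
Qed.

Lemma signs_agreeD (R : realType) d (y x w : 'rV[R]_d) :
  signs_agree y x -> signs_agree y w -> signs_agree y (x + w).
Proof.
by move=> yx yw k; rewrite (signs_agree_normD k yx yw) mxE mulrDr yx yw.
Qed.

Lemma cell_refl (R : realType) d (y : 'rV[R]_d) : cell y y.
Proof. by split=> // k; rewrite -normrEsg. Qed.

Lemma cell_trans (R : realType) d (x y z : 'rV[R]_d) :
  cell z y -> cell y x -> cell z x.
Proof.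
move=> [zy1 zy2] [yx1 yx2]; split=> [k|k zk]; last exact/yx2/zy2.
have [y0|y0] := eqVneq (y 0 k) 0.
  have := yx1 k; rewrite y0 sgr0 mul0r => /esym/normr0P/eqP ->.
  by rewrite mulr0 normr0.
by rewrite (sg_mul_norm_eq y0 (zy1 k)) yx1.
Qed.

Lemma cell0 (R : realType) d (y : 'rV[R]_d) : cell y 0.
Proof. by split=> k; rewrite mxE ?mulr0 !normr0. Qed.

Lemma cell_of0 (R : realType) d : cell 0 = [set 0] :> set 'rV[R]_d.
Proof.
rewrite eqEsubset; split=> [x [h _]|_ ->]; last exact: cell0.
apply/rowP => k; have := h k; rewrite !mxE sgr0 mul0r => /esym/normr0P/eqP.
by [].
Qed.

(** A coordinate where |y| is attained serves [x] and [w] at once, and no cancellation occurs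
    there. *)
Lemma cell_normD (R : realType) d (y x w : 'rV[R]_d) :
  cell y x -> cell y w -> `|x + w| = `|x| + `|w|.
Proof.
move=> [sx tx] [sw tw]; apply/eqP; rewrite eq_le ler_normD /=.
have [d0|d0] := posnP d.
  by move: x w {sx tx sw tw}; rewrite d0 => x w;
    rewrite (thinmx0 w) addr0 normr0 addr0.
have [k yk] := norm_row_attained y d0.
apply: le_trans (coord_le_norm _ k); rewrite (signs_agree_normD k sx sw).
by rewrite lerD ?tx ?tw ?yk.
Qed.

Lemma cellD (R : realType) d (y x w : 'rV[R]_d) :
  cell y x -> cell y w -> cell y (x + w).
Proof.
move=> yx yw; split=> [|k yk]; first by apply: signs_agreeD yx.1 yw.1.
rewrite (cell_normD yx yw) (signs_agree_normD k yx.1 yw.1).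
by rewrite lerD ?yx.2 ?yw.2.
Qed.

Lemma cellZ (R : realType) d (y x : 'rV[R]_d) (a : R) :
  0 <= a -> cell y x -> cell y (a *: x).
Proof.
move=> a0 [sx tx]; split=> [k|k yk].
  by rewrite mxE mulrCA sx normrM ger0_norm.
by rewrite mxE normrM normrZ ler_wpM2l // tx.
Qed.

(** Without cancellation a nonzero x_k keeps its sign in the sum, and |x| + |w| <= |x_k| + |w_k|
    gives |x| <= |x_k| because |w_k| <= |w|. *)
Lemma cell_addl (R : realType) d (y x w : 'rV[R]_d) :
  signs_agree y x -> signs_agree y w -> `|x + w| = `|x| + `|w| ->
  cell (x + w) x.
Proof.
move=> yx yw xw; have sxw := signs_agreeD yx yw; split=> [k|k].
  have [x0|x0] := eqVneq (x 0 k) 0; first by rewrite x0 mulr0 normr0.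
  rewrite -(sg_mul_norm_eq _ (sxw k)) ?yx // -normr_gt0.
  by rewrite (signs_agree_normD k yx yw) ltr_wpDr ?normr_gt0.
rewrite xw (signs_agree_normD k yx yw).
have := coord_le_norm x k; have := coord_le_norm w k; lra.
Qed.

Lemma cell_addl_cell (R : realType) d (y x w : 'rV[R]_d) :
  cell y x -> cell y w -> cell (x + w) x.
Proof. by move=> yx yw; apply: cell_addl yx.1 yw.1 (cell_normD yx yw). Qed.

(* The normals of the halfspaces that cut out [cell y].  When y_k = 0, the two
   indices [inl (k, b)] give x_k >= 0 and - x_k >= 0. *)
Definition cell_ineq (R : realType) d (y : 'rV[R]_d)
    (p : 'I_d * bool + 'I_d * 'I_d) : 'rV[R]_d :=
  match p with
  | inl (k, b) => (Num.sg (y 0 k) + (-1) ^+ b *+ (y 0 k == 0)) *: delta_mx 0 k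
  | inr (i, k) => (`|y| <= `|y 0 i|)%R%:R *:
      (Num.sg (y 0 i) *: delta_mx 0 i - Num.sg (y 0 k) *: delta_mx 0 k)
  end.

Lemma dotv_cell_ineq (R : realType) d (y x : 'rV[R]_d) p :
  dotv (cell_ineq y p) x =
  match p with
  | inl (k, b) => (Num.sg (y 0 k) + (-1) ^+ b *+ (y 0 k == 0)) * x 0 k
  | inr (i, k) => (`|y| <= `|y 0 i|)%R%:R *
      (Num.sg (y 0 i) * x 0 i - Num.sg (y 0 k) * x 0 k)
  end.
Proof.
case: p => -[i k] /=; rewrite dotvZl ?dotv_delta // dotvDl -scaleNr.
by rewrite !dotvZl !dotv_delta mulNr.
Qed.

Lemma cell_ineqP (R : realType) d (y x : 'rV[R]_d) :
  cell y x <-> forall p, 0 <= dotv (cell_ineq y p) x.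
Proof.
split=> [[sx tx] p|h].
  rewrite dotv_cell_ineq; case: p => -[i k].
    have [y0|y0] := eqVneq (y 0 i) 0; last by rewrite mulr0n addr0 sx.
    have := sx i; rewrite y0 sgr0 mul0r => /esym/normr0P/eqP ->.
    by rewrite mulr0.
  case: (boolP (`|y| <= `|y 0 i|)) => yi; last by rewrite mul0r.
  rewrite mul1r !sx subr_ge0; apply: le_trans (tx i yi); exact: coord_le_norm.
have sx : signs_agree y x.
  move=> k; have := h (inl (k, true)); have := h (inl (k, false)).
  rewrite !dotv_cell_ineq /= expr0 expr1.
  have [y0|y0] := eqVneq (y 0 k) 0.
    rewrite y0 sgr0 !add0r mul1r mulN1r mul0r oppr_ge0 => x0 x0'.
    by apply/esym/normr0P; rewrite eq_le x0 x0'.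
  rewrite mulr0n addr0 => hk _; rewrite -[LHS]ger0_norm // normrM.
  by rewrite normr_sg y0 mul1r.
split=> // k yk; apply: norm_row_le => // i.
have := h (inr (k, i)); rewrite dotv_cell_ineq yk mul1r !sx; lra.
Qed.

Lemma polyhedral_cone_fin (R : realType) d (I : finType) (u : I -> 'rV[R]_d) :
  polyhedral_cone [set x | forall k, 0 <= dotv (u k) x].
Proof.
exists #|I|, (u \o enum_val); rewrite eqEsubset; split=> x /= h k //.
by rewrite -(enum_rankK k).
Qed.

Lemma cell_polyhedral (R : realType) d (y : 'rV[R]_d) :
  polyhedral_cone (cell y).
Proof.
have -> : cell y = [set x | forall p, 0 <= dotv (cell_ineq y p) x].
  by rewrite eqEsubset; split=> x /cell_ineqP.
exact: polyhedral_cone_fin.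
Qed.

(** [y] is relatively interior to its cell: inequalities tight at [y] are tight on the whole cell,
    and the finitely many others leave room for a small step away from [x]. *)
Lemma cell_retract (R : realType) d (y x : 'rV[R]_d) :
  cell y x -> exists2 e : R, 0 < e & cell y (y - e *: x).
Proof.
move=> yx; have yy := cell_refl y.
suff : \forall e \near 0^'+, forall p, 0 <= dotv (cell_ineq y p) (y - e *: x).
  move=> near_e;
    have : \forall e \near (0 : R)^'+, 0 < e /\ cell y (y - e *: x).
    near=> e; split; first by near: e; exact: nbhs_right_gt.
    by apply/cell_ineqP => p; move: p; near: e.
  by move=> /filter_ex [e [e0 ye]]; exists e.
apply: filter_forall => p.
have [y0|y0] := eqVneq (dotv (cell_ineq y p) y) 0.
  suff x0 : dotv (cell_ineq y p) x = 0.
    by near=> e; rewrite dotvB dotvZ y0 x0 mulr0 subr0.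
  move: y0; rewrite !dotv_cell_ineq; case: p => -[i k].
    have [y0 _|y0] := eqVneq (y 0 i) 0.
      have := yx.1 i; rewrite y0 sgr0 mul0r => /esym/normr0P/eqP ->.
      by rewrite mulr0.
    by rewrite mulr0n addr0 -normrEsg => /normr0P; rewrite (negbTE y0).
  case: (boolP (`|y| <= `|y 0 i|)) => yi; last by rewrite !mul0r.
  rewrite !mul1r !yx.1 !yy.1 => /subr0_eq yik; apply/eqP;
    rewrite subr_eq0 eq_le.
  apply/andP; split; apply: le_trans (coord_le_norm _ _) (yx.2 _ _) => //.
  by rewrite -yik.
have [ux|ux] := leP (dotv (cell_ineq y p) x) 0.
  near=> e; rewrite dotvB dotvZ subr_ge0 (le_trans (y := 0)) //.
    by rewrite mulr_ge0_le0 //; near: e; exact: nbhs_right_ge.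
  exact: (cell_ineqP y y).1.
near=> e; rewrite dotvB dotvZ subr_ge0 -ler_pdivlMr //.
near: e; apply: nbhs_right_ltW; rewrite divr_gt0 // lt0r y0.
exact: (cell_ineqP y y).1.
Unshelve. all: by end_near.
Qed.

Definition cell_pattern (R : realType) d (y : 'rV[R]_d) :
    {ffun 'I_d -> bool * bool * bool} :=
  [ffun k => (0 < y 0 k, y 0 k < 0, `|y| <= `|y 0 k|)].

Lemma cell_pattern_eq (R : realType) d (x y : 'rV[R]_d) :
  cell_pattern x = cell_pattern y -> cell y x.
Proof.
move=> xy; have {}xy k := congr1 (fun f : {ffun _} => f k) xy.
split=> [k|k yk]; have := xy k; rewrite !ffunE => -[pos neg top]; last first.
  by rewrite top.
have -> : Num.sg (y 0 k) = Num.sg (x 0 k).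
  move: pos neg; case: (ltrgt0P (x 0 k)) => [xk|xk|->];
    by case: (ltrgt0P (y 0 k)) => [yk|yk|->] // _ _;
      rewrite ?sgr0 ?(gtr0_sg xk) ?(gtr0_sg yk) ?(ltr0_sg xk) ?(ltr0_sg yk).
by rewrite -normrEsg.
Qed.

(* z is the sum of one representative for each cell pattern occurring in A; it
   plays the role of a relatively interior point. *)
Lemma exists_dominating (R : realType) d (A : set 'rV[R]_d) :
  A 0 -> (forall x w, A x -> A w -> A (x + w)) ->
  exists2 z, A z & forall x, A x ->
    exists x' w, [/\ A x', A w, cell x' x & z = x' + w].
Proof.
move=> A0 AD; pose S s := [set x | A x /\ cell_pattern x = s].
pose rep s := xget 0 (S s).
(* A pattern that does not occur in [A] gets the default 0, which also lies in [A]. *)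
have Arep s : A (rep s) by rewrite /rep; case: xgetP => // x _ [].
have Asum P : A (\sum_(s | P s) rep s) by elim/big_ind: _.
exists (\sum_s rep s) => [|x Ax]; first exact: Asum.
exists (rep (cell_pattern x)), (\sum_(s | s != cell_pattern x) rep s).
split=> //; last by rewrite (bigD1 (cell_pattern x)).
apply: cell_pattern_eq; rewrite /rep.
by case: xgetP => [y _ []//|/(_ x) []].
Qed.

(** A dominating [z] splits as [x' + w] with [x] in [cell x']; the last hypothesis puts [x'] in
    [cell z], and transitivity puts [x] there. This criterion recognises faces, intersections and
    refinements as cells. *)
Lemma eq_cell_of_cone (R : realType) d (A : set 'rV[R]_d) :
  A 0 -> (forall x w, A x -> A w -> A (x + w)) ->
  (forall z w, A z -> cell z w -> A w) ->
  (forall x w, A x -> A w -> cell (x + w) x) ->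
  exists2 z, A z & A = cell z.
Proof.
move=> A0 AD Adown Acell; have [z Az zdom] := exists_dominating A0 AD.
exists z => //; rewrite eqEsubset; split=> x; last exact: Adown.
move=> /zdom [x' [w [Ax' Aw xx' ->]]]; apply: cell_trans xx'.
exact: Acell.
Qed.

(** * Faces and intersections of cells; the fan of cells *)

(** The origin gives c >= 0, and doubling a point of the face gives 2c <= c. *)
Lemma face_cone (R : realType) d (C F : set 'rV[R]_d) :
  C 0 -> (forall (a : R) x, 0 <= a -> C x -> C (a *: x)) -> face C F ->
    F !=set0 ->
  exists2 u, (forall x, C x -> dotv u x <= 0) &
    F = C `&` [set x | dotv u x = 0].
Proof.
move=> C0 CZ [u [c [uc ->]]] [x /= [Cx uxc]].
suff c0 : c = 0 by exists u; rewrite -c0.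
have := uc _ C0; rewrite dotv0 => c_ge0.
have := uc _ (CZ 2 x (ler0n R 2) Cx); rewrite dotvZ uxc; lra.
Qed.

Lemma face_cell_is_cell (R : realType) d (y : 'rV[R]_d) F :
  face (cell y) F -> F !=set0 -> exists z, F = cell z.
Proof.
move=> yF F0; have [|a x|u uy ->] := face_cone _ _ yF F0.
- exact: cell0.
- exact: cellZ.
have [||||z _ zE] := @eq_cell_of_cone _ _ (cell y `&` [set x | dotv u x = 0]).
- by split; [exact: cell0|exact: dotv0].
- move=> x w [yx ux] [yw uw]; split; first exact: cellD.
  by rewrite /= dotvD ux uw addr0.
- move=> z w [yz uz] zw; have yw := cell_trans yz zw; split=> //=.
  (* [z - e *: w] stays in [cell y], where [u] is nonpositive; since [u] vanishes at [z], it is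
     nonnegative at [w]. *)
  have [e e0 ze] := cell_retract zw.
  have := uy _ (cell_trans yz ze); rewrite dotvB dotvZ uz sub0r oppr_le0.
  rewrite pmulr_rge0 // => uw; apply/eqP; rewrite eq_le uw andbT.
  exact: uy.
- by move=> x w [yx _] [yw _]; exact: cell_addl_cell yx yw.
by exists z.
Qed.

(** The inequality holds both at [x] and at [w - e *: x]; if it is tight at [w], only 0 remains. *)
Lemma cell_ineq_vanish (R : realType) d (y w x : 'rV[R]_d) p :
  cell y w -> cell w x -> dotv (cell_ineq y p) w = 0 ->
  dotv (cell_ineq y p) x = 0.
Proof.
move=> yw wx uw; have [e e0 we] := cell_retract wx.
have := (cell_ineqP y _).1 (cell_trans yw we) p.
rewrite dotvB dotvZ uw sub0r oppr_ge0 pmulr_rle0 // => ux.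
apply/eqP; rewrite eq_le ux; exact: (cell_ineqP y _).1 (cell_trans yw wx) p.
Qed.

(** Converse of [cell_ineq_vanish]: sign inequalities detect the zero coordinates of [w], and
    comparisons with a top coordinate of [y] detect where |w| is attained. *)
Lemma cell_of_vanishing (R : realType) d (y w x : 'rV[R]_d) :
  cell y w -> cell y x ->
  (forall p, dotv (cell_ineq y p) w = 0 -> dotv (cell_ineq y p) x = 0) ->
  cell w x.
Proof.
move=> yw yx h; split=> [k|i wi].
  have [w0|w0] := eqVneq (w 0 k) 0; last first.
    by rewrite -(sg_mul_norm_eq w0 (yw.1 k)) yx.1.
  have := h (inl (k, false)); rewrite !dotv_cell_ineq /= w0 mulr0 => /(_ erefl).
  have [y0 _|y0] := eqVneq (y 0 k) 0.
    have := yx.1 k; rewrite y0 sgr0 mul0r => /esym/normr0P/eqP ->.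
    by rewrite !(mulr0, mul0r, sgr0, normr0).
  by rewrite mulr0n addr0 yx.1 => ->; rewrite sgr0 mul0r.
have [j yj] := norm_row_attained y (ord_dim_gt0 i).
have {}yj : `|y| <= `|y 0 j| by rewrite yj.
have := h (inr (j, i)); rewrite !dotv_cell_ineq yj !mul1r !yw.1 !yx.1.
have -> : `|w 0 j| = `|w 0 i|.
  apply/eqP; rewrite eq_le (le_trans (coord_le_norm _ _) wi).
  exact: le_trans (coord_le_norm _ _) (yw.2 _ yj).
rewrite subrr => /(_ erefl)/subr0_eq <-; exact: yx.2.
Qed.

(** Minus the sum of all normals tight at [w] supports the face: a sum of nonnegative terms vanishes
    only if each term does. *)
Lemma face_cell (R : realType) d (y w : 'rV[R]_d) :
  cell y w -> face (cell y) (cell w).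
Proof.
move=> yw; pose P p := dotv (cell_ineq y p) w == 0.
pose u := - \sum_(p | P p) cell_ineq y p.
have uE x : dotv u x = - \sum_(p | P p) dotv (cell_ineq y p) x.
  rewrite /u -scaleN1r dotvZl mulN1r; congr (- _).
  elim/big_rec2: _ => [|p a b _ <-]; last by rewrite dotvDl.
  by rewrite dotv0l.
have ge0 x p : cell y x -> 0 <= dotv (cell_ineq y p) x.
  by move=> yx; exact: (cell_ineqP y x).1.
exists u, 0; split=> [x yx|].
  by rewrite uE oppr_le0; apply: sumr_ge0 => p _; exact: ge0.
rewrite eqEsubset; split=> [x wx|x [yx /eqP]].
  split; first exact: cell_trans wx.
  rewrite /= uE big1 ?oppr0 // => p /eqP; exact: cell_ineq_vanish.
rewrite uE oppr_eq0 psumr_eq0 => [/allP h|p _]; last exact: ge0.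
apply: cell_of_vanishing yw yx _ => p /eqP wp.
by apply/eqP; move: (h p (mem_index_enum p)); rewrite /P wp.
Qed.

Lemma cellI (R : realType) d (y z : 'rV[R]_d) :
  exists2 w, cell y w /\ cell z w & cell y `&` cell z = cell w.
Proof.
apply: eq_cell_of_cone.
- by split; exact: cell0.
- by move=> x w [yx zx] [yw zw]; split; exact: cellD.
- by move=> x w [yx zx] xw; split; apply: cell_trans xw.
- by move=> x w [yx _] [yw _]; exact: cell_addl_cell yx yw.
Qed.

Definition cell_fan (R : realType) d : set (set 'rV[R]_d) :=
  [set cell y | y in [set: 'rV[R]_d]].

Lemma cell_fan_polyhedral (R : realType) d : polyhedral_fan (@cell_fan R d).
Proof.
split=> [|C [y _ <-]|C F [y _ <-] yF F0|C C' [y _ <-] [z _ <-]].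
(* A cell depends only on the pattern of its point, so the fan lies in the image of a finite
   type. *)
- pose g s := cell (xget (0 : 'rV[R]_d) [set x | cell_pattern x = s]).
  apply: (@sub_finite_set _ _ (g @` setT));
    last exact/finite_image/finite_finset.
  move=> _ [y _ <-]; exists (cell_pattern y) => //; rewrite /g.
  case: xgetP => [x _ /= xy|/(_ y)/(_ erefl)[]].
  by rewrite eqEsubset; split=> z; apply: cell_trans; exact: cell_pattern_eq.
- exact: cell_polyhedral.
- by have [z ->] := face_cell_is_cell yF F0; exists z.
- have [w [yw zw] ->] := cellI y z; split; exact: face_cell.
Qed.

(** * The face fan of the cube and the common refinement *)

Lemma cubeE (R : realType) d (x : 'rV[R]_d) : @cube R d x <-> `|x| <= 1.
Proof.
split=> [cx|x1 i]; last by rewrite -ler_norml (le_trans (coord_le_norm x i)).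
by apply: norm_row_le => // i; rewrite ler_norml.
Qed.

Lemma valid_cube_norm (R : realType) d (u x : 'rV[R]_d) c :
  (forall v, @cube R d v -> dotv u v <= c) -> dotv u x <= c * `|x|.
Proof.
move=> uc; have [->|x0] := eqVneq x 0; first by rewrite dotv0 normr0 mulr0.
have x_gt0 : 0 < `|x| by rewrite normr_gt0.
rewrite -ler_pdivrMr // mulrC -dotvZ; apply: uc; apply/cubeE.
by rewrite normrZ ger0_norm ?invr_ge0 // mulVf // gt_eqF.
Qed.

(** By [valid_cube_norm] the right side is the equality case of u.x <= c |x|. The triangle
    inequality gives one inclusion; for the other, a nonzero [x] is |x| times a point of the
    face. *)
Lemma cone_cube_face (R : realType) d (u : 'rV[R]_d) c : 0 < c ->
  (forall v, @cube R d v -> dotv u v <= c) ->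
  cone (@cube R d `&` [set x | dotv u x = c]) = [set x | c * `|x| <= dotv u x].
Proof.
move=> c0 uc; rewrite eqEsubset; split=> [_ [n [l [v [l0 Fv ->]]]]|x /= cx].
  rewrite /= dotv_sum.
  have -> : \sum_k dotv u (l k *: v k) = c * \sum_k l k.
    by rewrite mulr_sumr; apply: eq_bigr => k _; rewrite dotvZ (Fv k).2 mulrC.
  rewrite ler_pM2l //; apply: le_trans (ler_norm_sum _ _ _) _.
  apply: ler_sum => k _; rewrite normrZ ger0_norm // ler_piMr //.
  exact/cubeE/(Fv k).1.
have [->|x0] := eqVneq x 0.
  exists 0%N, (fun=> 0), (fun=> 0); split=> [[]//|[]//|].
  by rewrite big_ord0.
have x_gt0 : 0 < `|x| by rewrite normr_gt0.
have x_neq0 : `|x| != 0 by rewrite gt_eqF.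
exists 1%N, (fun=> `|x|), (fun=> `|x|^-1 *: x); split=> // [_|].
  split; first by apply/cubeE; rewrite normrZ ger0_norm ?invr_ge0 // mulVf.
  have -> : c = `|x|^-1 * (c * `|x|) by rewrite mulrC mulfK.
  rewrite /= dotvZ; congr (_ * _); apply/eqP; rewrite eq_le cx andbT.
  exact: valid_cube_norm.
by rewrite big_ord1 scalerA mulfV // scale1r.
Qed.

(** The origin gives c >= 0. If c were 0, symmetry of the cube would make [u] vanish on it, and the
    face would be the whole cube. *)
Lemma proper_face_cube (R : realType) d (F : set 'rV[R]_d) :
  proper_face (@cube R d) F ->
  exists u c, [/\ 0 < c, forall v, @cube R d v -> dotv u v <= c &
    F = @cube R d `&` [set x | dotv u x = c]].
Proof.
move=> [[u [c [uc FE]]] [_ /= FP]]; exists u, c; split=> //.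
have cube_opp v : @cube R d v -> @cube R d (- v) by move=> /cubeE ?;
  apply/cubeE; rewrite normrN.
have cube0 : @cube R d (0 : 'rV[R]_d) by apply/cubeE; rewrite normr0.
rewrite lt0r; have := uc _ cube0; rewrite dotv0 => -> /=; rewrite andbT.
apply/eqP => c0; apply: FP => v cv; rewrite FE; split=> //=.
have := uc _ cv; have := uc _ (cube_opp _ cv).
rewrite -scaleN1r dotvZ c0; lra.
Qed.

Lemma proper_face_cube_intro (R : realType) d (u : 'rV[R]_d) c : 0 < c ->
  (forall v, @cube R d v -> dotv u v <= c) ->
  proper_face (@cube R d) (@cube R d `&` [set x | dotv u x = c]).
Proof.
move=> c0 uc; split; first by exists u, c.
split=> [x []//|/(_ 0)[|_ /=]]; first by apply/cubeE; rewrite normr0.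
by rewrite dotv0 => c0E; rewrite -c0E ltxx in c0.
Qed.

Lemma coordinate_fanE (R : realType) d :
  @coordinate_fan R d = [set [set x | signs_agree y x] | y in setT].
Proof.
apply: eq_imagel => y _; rewrite eqEsubset.
by split=> x /= h k; have := h k; rewrite !dotv_delta sg_mul_norm_iff.
Qed.

Lemma refinement_cell (R : realType) d (y u : 'rV[R]_d) c : 0 < c ->
  (forall v, @cube R d v -> dotv u v <= c) ->
  exists z, [set x | signs_agree y x] `&` [set x | c * `|x| <= dotv u x] =
    cell z.
Proof.
move=> c0 uc; have uc' x := valid_cube_norm x uc.
have normD x w : c * `|x| <= dotv u x -> c * `|w| <= dotv u w ->
    `|x + w| = `|x| + `|w|.
  move=> ux uw; apply/eqP; rewrite eq_le ler_normD /= -(ler_pM2l c0).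
  by apply: le_trans (uc' _); rewrite dotvD mulrDr lerD.
have [||||z _ zE] := @eq_cell_of_cone _ _
  ([set x | signs_agree y x] `&` [set x | c * `|x| <= dotv u x]).
- by split=> [k|]; rewrite /= ?mxE ?dotv0 ?normr0 ?mulr0.
- move=> x w [sx ux] [sw uw]; split; first exact: signs_agreeD.
  by rewrite /= (normD _ _ ux uw) dotvD mulrDr lerD.
- move=> z w [sz uz] zw; split=> [k|/=].
    have [z0|z0] := eqVneq (z 0 k) 0; last first.
      by rewrite (sg_mul_norm_eq z0 (sz k)) zw.1.
    have := zw.1 k; rewrite z0 sgr0 mul0r => /esym/normr0P/eqP ->.
    by rewrite mulr0 normr0.
  (* The bound u.x <= c |x| is attained at [z], the sum of [z - e *: w] and [e *: w], and norms add
     along this sum; hence it is attained at [w]. *)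
  have [e e0 ze] := cell_retract zw.
  have := cell_normD ze (cellZ (ltW e0) zw); rewrite subrK normrZ gtr0_norm //.
  have := uc' (z - e *: w); rewrite dotvB dotvZ => uze zE.
  rewrite -(ler_pM2l e0); move: uz uze; rewrite /= zE; lra.
- move=> x w [sx ux] [sw uw]; apply: cell_addl sx sw _; exact: normD.
by exists z.
Qed.

Lemma common_refinementE (R : realType) d :
  common_refinement (@coordinate_fan R d) (face_fan (@cube R d)) =
  @cell_fan R d.
Proof.
rewrite /common_refinement coordinate_fanE eqEsubset; split.
  move=> _ [_ [y _ <-] [_ [F /proper_face_cube [u [c [c0 uc ->]]] <-] <-]].
  rewrite cone_cube_face //; have [z ->] := refinement_cell y c0 uc.
  by exists z.
move=> _ [y _ <-]; exists [set x | signs_agree y x]; first by exists y.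
pose top k := `|y| <= `|y 0 k|.
(* [u] sums the signed unit vectors over the coordinates where |y| is attained and [c] counts them,
   so equality in u.x <= c |x| makes each of them attain |x|. For [y = 0], the pair (0, 1) cuts out
   the empty face, with cone {0}. *)
pose u := if y == 0 then 0 else \row_k (Num.sg (y 0 k) *+ top k).
pose c : R := if y == 0 then 1 else \sum_(k | top k) 1.
have uE x : y != 0 -> dotv u x = \sum_(k | top k) Num.sg (y 0 k) * x 0 k.
  move=> /negbTE y0; rewrite /u y0 [RHS]big_mkcond; apply: eq_bigr => k _.
  by rewrite mxE; case: (top k); rewrite ?mulr1n ?mulr0n ?mul0r.
have c0 : 0 < c.
  rewrite /c; case: ifP => // /negbT y0.
  have d0 : (0 < d)%N.
    by rewrite lt0n; apply: contraNN y0 => /eqP d0; move: y {top u c uE};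
      rewrite d0 => y; rewrite (thinmx0 y).
  have [j yj] := norm_row_attained y d0.
  by rewrite (bigD1 j) ?ltr_wpDr ?sumr_ge0 // /top yj.
have uc v : @cube R d v -> dotv u v <= c.
  move=> /cubeE v1; have [y0|y0] := eqVneq y 0.
    by rewrite /u /c y0 eqxx dotv0l.
  rewrite uE // /c (negbTE y0); apply: ler_sum => k _.
  apply: le_trans (sg_mul_le_norm _ _) _;
    exact: le_trans (coord_le_norm _ _) v1.
exists (cone (@cube R d `&` [set x | dotv u x = c])).
  by exists (@cube R d `&` [set x | dotv u x = c]) => //;
    exact: proper_face_cube_intro.
rewrite cone_cube_face // eqEsubset; have [y0|y0] := eqVneq y 0.
  rewrite /u /c y0 eqxx cell_of0; split=> [x [_ /=]|_ ->].
    by rewrite dotv0l mul1r normr_le0 => /eqP.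
  by split=> [k|]; rewrite /= ?mxE ?dotv0 normr0 ?mulr0.
have cE x : c * `|x| = \sum_(k | top k) `|x|.
  by rewrite /c (negbTE y0) mulr_suml; apply: eq_bigr => k _; rewrite mul1r.
have uEs x : signs_agree y x -> dotv u x = \sum_(k | top k) `|x 0 k|.
  by move=> sx; rewrite uE //; apply: eq_bigr => k _; exact: sx.
split=> x [sx /= tx]; split=> //.
  rewrite cE uEs // -subr_ge0 -sumrB in tx.
  (* All terms |x_j| - |x| of the sum in [tx] are nonpositive, so the sum is at most any single
     term. *)
  move=> k yk; rewrite -subr_ge0; apply: le_trans tx _.
  rewrite (bigD1 k) //= gerDl -oppr_ge0 -sumrN; apply: sumr_ge0 => j _.
  by rewrite opprB subr_ge0 coord_le_norm.
by rewrite /= cE uEs //; apply: ler_sum => k yk; exact: tx.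
Qed.

(** * Facets of the cube *)

Definition signed_facet (R : realType) d (i : 'I_d) (b : bool) :
    set 'rV[R]_d :=
  @cube R d `&` [set x | dotv ((-1) ^+ b *: delta_mx 0 i) x = 1].
Arguments signed_facet R {d} i b.

Lemma signed_facet_valid (R : realType) d (i : 'I_d) (b : bool) (v : 'rV[R]_d) :
  @cube R d v -> dotv ((-1) ^+ b *: delta_mx 0 i) v <= 1.
Proof.
move=> /cubeE v1; rewrite dotvZl dotv_delta.
by apply: le_trans v1; apply: le_trans (coord_le_norm v i);
  rewrite -(normrMsign b) ler_norm.
Qed.

Lemma sub_signed_facet (R : realType) d (F : set 'rV[R]_d) :
  (0 < d)%N -> proper_face (@cube R d) F ->
  exists i b, F `<=` signed_facet R i b.
Proof.
move=> d0 /proper_face_cube [u [c [c0 uc ->]]].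
have [u0|/eqP/rowP] := eqVneq u 0.
  (* Since [c] is positive, the face is empty and lies in any signed facet. *)
  by exists (Ordinal d0), false => x [_ /=]; rewrite u0 dotv0l; lra.
move=> /existsNP [i]; rewrite mxE => /eqP ui.
exists i, (u 0 i < 0) => v [/cubeE v1 /= uv]; split; first exact/cubeE.
set s := (-1) ^+ _ : R; rewrite /= dotvZl dotv_delta.
have svi : s * v 0 i <= 1.
  rewrite (le_trans (ler_norm _)) // /s normrMsign.
  exact: le_trans (coord_le_norm _ _) v1.
have su : s * u 0 i = `|u 0 i| by rewrite [RHS]normrEsign.
(* Moving v within the cube along the i-th axis cannot increase u. *)
have /uc : @cube R d (v + (s - v 0 i) *: delta_mx 0 i).
  apply/cubeE; apply: norm_row_le => // k; rewrite !mxE eqxx /=.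
  have [->|ki] := eqVneq k i.
    by rewrite mulr1 addrC subrK normr_sign.
  by rewrite mulr0 addr0; exact: le_trans (coord_le_norm _ _) v1.
have -> : dotv u (v + (s - v 0 i) *: delta_mx 0 i) = c + (s - v 0 i) * u 0 i.
  rewrite dotvD dotvZ uv; congr (_ + _ * _).
  by rewrite /dotv -(dotv_delta i u); apply: eq_bigr => k _; rewrite mulrC.
move=> le_c; apply/eqP; rewrite eq_le svi /=.
have ss : s * s = 1 by rewrite -expr2 sqrr_sign.
have : (1 - s * v 0 i) * `|u 0 i| <= 0.
  by rewrite -su mulrA mulrBl mul1r mulrAC ss mul1r -(lerD2l c) addr0.
by rewrite pmulr_lle0 ?normr_gt0 // subr_le0.
Qed.

(** The centre of a signed facet, a signed unit vector, lies on no other one. *)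
Lemma signed_facet_sub_inj (R : realType) d (i j : 'I_d) (b b' : bool) :
  signed_facet R i b `<=` signed_facet R j b' -> i = j /\ b = b'.
Proof.
move=> /(_ ((-1) ^+ b *: delta_mx 0 i))[].
  split; last first.
    by rewrite /= dotvZl dotv_delta !mxE !eqxx mulr1 -expr2 sqrr_sign.
  apply/cubeE; apply: norm_row_le => // k.
  by rewrite !mxE normrMsign eqxx; case: eqP; rewrite ?normr1 ?normr0.
rewrite /= dotvZl dotv_delta !mxE eqxx /= => _.
have [->|] := eqVneq j i; last by rewrite !mulr0 => _ /esym/eqP;
  rewrite oner_eq0.
rewrite mulr1; case: b; case: b'; rewrite ?expr0 ?expr1 => h; split=> //; lra.
Qed.

Lemma facet_cubeP (R : realType) d (F : set 'rV[R]_d) : (0 < d)%N ->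
  facet (@cube R d) F <-> exists i b, F = signed_facet R i b.
Proof.
have pf i b : proper_face (@cube R d) (signed_facet R i b).
  apply: proper_face_cube_intro => // v; exact: signed_facet_valid.
move=> d0; split=> [[/(sub_signed_facet d0) [i [b Fib]] Fmax]|[i [b ->]]].
  by exists i, b; apply/esym; exact: Fmax.
split=> // B /(sub_signed_facet d0) [j [b' Bj]] iB.
have [ij bb'] := signed_facet_sub_inj (subset_trans iB Bj).
by rewrite eqEsubset; split=> //; rewrite ij bb'.
Qed.

(** * Nonemptiness of the parts of a bisector *)

Lemma bisector_part_signed (R : realType) d (i j : 'I_d) b b' (c : 'rV[R]_d) :
  bisector_part (signed_facet R i b) (signed_facet R j b') 0 c !=set0 <->
  exists x, [/\ `|x| = `|x - c|, `|x| <= (-1) ^+ b * x 0 i &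
    `|x - c| <= (-1) ^+ b' * (x 0 j - c 0 j)].
Proof.
have coneE k e : cone (signed_facet R k e) =
    [set x : 'rV[R]_d | `|x| <= (-1) ^+ e * x 0 k].
  rewrite cone_cube_face // => [|v]; last exact: signed_facet_valid.
  by apply/seteqP; split=> x /=; rewrite dotvZl dotv_delta mul1r.
have cE (x : 'rV[R]_d) : (x - c) 0 j = x 0 j - c 0 j by rewrite !mxE.
rewrite /bisector_part !coneE; split.
  move=> [x [[/= bx [y /= yb yx]] [z /= zb zx]]]; exists x.
  rewrite addr0 in yx; rewrite /bisector /= subr0 in bx; split=> //;
    first by rewrite -yx.
  by rewrite -cE -zx addrK.
move=> [x [bx xb xb']]; exists x; split; first split.
- by rewrite /= /bisector /= subr0.
- by exists x => //; rewrite addr0.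
- by exists (x - c); rewrite ?subrK //= cE.
Qed.

(** On this part |x| = s x_i and |x - c| = s (x_i - c_i) with the same sign s, so equal norms force
    c_i = 0. *)
Lemma bisector_part_same (R : realType) d (i : 'I_d) b (c : 'rV[R]_d) :
  bisector_part (signed_facet R i b) (signed_facet R i b) 0 c !=set0 <->
  c 0 i = 0.
Proof.
rewrite bisector_part_signed; split=> [[x [bx xb xb']]|ci].
  have := coord_le_norm x i; have := coord_le_norm (x - c) i.
  rewrite !mxE !ler_norml => /andP[]; move: bx xb xb'.
  by case: b; rewrite ?expr0 ?expr1 => *; lra.
pose e : 'rV[R]_d := delta_mx 0 i; pose s : R := (-1) ^+ b.
have e1 : `|(s * `|c|) *: e| = `|c|.
  rewrite normrZ normrM normr_sign normr_id mul1r [X in _ * X](_ : _ = 1)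
    ?mulr1 //.
  apply/le_anti/andP; split.
    by apply: norm_row_le => // k; rewrite !mxE eqxx; case: eqP;
      rewrite ?normr1 ?normr0.
  by apply: le_trans (coord_le_norm _ i); rewrite !mxE !eqxx normr1.
have ss : s * s = 1 by rewrite -expr2 sqrr_sign.
have xc : c + (s * `|c|) *: e - c = (s * `|c|) *: e by rewrite addrC addKr.
(* Moving from [c] by |c| along the facet direction gives [x] and [x - c] the norm |c|, attained at
   [i]. *)
exists (c + (s * `|c|) *: e); rewrite xc e1.
have cn : `|c + (s * `|c|) *: e| = `|c|.
  apply/le_anti/andP; split.
    apply: norm_row_le => // k; rewrite !mxE /=.
    have [->|ki] := eqVneq k i; last by rewrite mulr0 addr0 coord_le_norm.
    by rewrite ci add0r mulr1 normrM normr_sign mul1r normr_id.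
  apply: le_trans (coord_le_norm _ i); rewrite !mxE !eqxx ci add0r mulr1.
  by rewrite normrM normr_sign mul1r normr_id.
by split=> //; rewrite ?cn !mxE !eqxx ci ?subr0 add0r mulr1 mulrA ss mul1r.
Qed.

(** Necessity is the triangle inequality through [x]; the midpoint of 0 and [c] is the witness. *)
Lemma bisector_part_opposite (R : realType) d (i : 'I_d) b (c : 'rV[R]_d) :
  bisector_part (signed_facet R i b) (signed_facet R i (~~ b)) 0 c !=set0 <->
  `|c| <= (-1) ^+ b * c 0 i.
Proof.
rewrite bisector_part_signed signrN; split=> [[x [bx xb xb']]|cb].
  have : `|c| <= `|x| + `|x - c|.
    by rewrite -(normrN (x - c)) (le_trans _ (ler_normD _ _)) // opprB addrC
      subrK.
  move: xb xb'; case: (b); rewrite ?expr0 ?expr1 => *; lra.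
have cc : 2^-1 *: c - c = - (2^-1 *: c).
  by apply/rowP => k; rewrite !mxE; lra.
have n2 : `|2^-1 *: c| = 2^-1 * `|c| by rewrite normrZ ger0_norm // invr_ge0.
exists (2^-1 *: c); rewrite cc normrN n2 !mxE; split=> //.
  by rewrite mulrCA ler_pM2l // invr_gt0.
by move: cb; lra.
Qed.

Lemma bisector_part_distinct (R : realType) d (i j : 'I_d) b b'
    (c : 'rV[R]_d) : i != j ->
  bisector_part (signed_facet R i b) (signed_facet R j b') 0 c !=set0 <->
  0 <= (-1) ^+ b * c 0 i /\ (-1) ^+ b' * c 0 j <= 0.
Proof.
move=> ij; rewrite bisector_part_signed; split=> [[x [bx xb xb']]|[ci cj]].
  have := coord_le_norm x j; have := coord_le_norm (x - c) i.
  rewrite !mxE !ler_norml; move: bx xb xb'.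
  by case: b; case: b'; rewrite ?expr0 ?expr1 => ? ? ? /andP[? ?] /andP[? ?];
    lra.
pose r := `|c|; have r0 : 0 <= r := normr_ge0 c.
pose s : R := (-1) ^+ b; pose t : R := (-1) ^+ b'.
have rk k : - r <= c 0 k <= r by rewrite -ler_norml coord_le_norm.
have sE : s = 1 \/ s = -1 by rewrite /s; case: (b); [right|left].
have tE : t = 1 \/ t = -1 by rewrite /t; case: (b'); [right|left].
rewrite -/s in ci *; rewrite -/t in cj *; clearbody r s t.
(* Coordinate [i] carries the norm of [x] and coordinate [j] that of [x - c], both equal to [r]. The
   sign hypotheses keep x_j and x_i - c_i within [r]. *)
pose x : 'rV[R]_d := \row_k (if k == i then s * r else
                             if k == j then c 0 j + t * r else c 0 k).
have /andP[ci1 ci2] := rk i; have /andP[cj1 cj2] := rk j.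
have xi : x 0 i = s * r by rewrite mxE eqxx.
have xj : x 0 j = c 0 j + t * r by rewrite mxE eq_sym (negbTE ij) eqxx.
have sxi : s * x 0 i = r by rewrite xi; case: sE => ->; lra.
have txj : t * (x 0 j - c 0 j) = r by rewrite xj; case: tE => ->; lra.
have xr : `|x| <= r.
  apply: norm_row_le => // k; rewrite mxE.
  have [_|ki] := eqVneq k i.
    by rewrite ler_norml; case: sE => ->; lra.
  have [_|kj] := eqVneq k j; last by rewrite ler_norml.
  by rewrite ler_norml; case: tE cj => ->; lra.
have xcr : `|x - c| <= r.
  apply: norm_row_le => // k; rewrite !mxE.
  have [->|ki] := eqVneq k i.
    by rewrite ler_norml; case: sE ci => ->; lra.
  have [->|kj] := eqVneq k j; last by rewrite subrr normr0.
  by rewrite ler_norml; case: tE => ->; lra.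
have rx : `|x| = r.
  apply/le_anti; rewrite xr /=; apply: le_trans (coord_le_norm _ i).
  rewrite -sxi (le_trans (ler_norm _)) // normrM.
  by case: sE => ->; rewrite ?normrN1 ?normr1 mul1r.
have rxc : `|x - c| = r.
  apply/le_anti; rewrite xcr /=; apply: le_trans (coord_le_norm _ j).
  rewrite !mxE /= eq_sym (negbTE ij) eqxx.
  rewrite (_ : c 0 j + t * r - c 0 j = t * r); last by lra.
  by rewrite normrM; case: tE => ->; rewrite ?normrN1 ?normr1 mul1r ler_norm.
by exists x; rewrite rx rxc sxi txj.
Qed.

Lemma signs_agree_mul (R : realType) d (a b : 'rV[R]_d) (e : bool) k :
  signs_agree a b -> 0 <= (-1) ^+ e * a 0 k -> (-1) ^+ e * b 0 k = `|b 0 k|.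
Proof.
move=> ab ea; have [->|b0] := eqVneq (b 0 k) 0; first by rewrite mulr0 normr0.
have := ab k; case: (sgrP (a 0 k)) ea => [_ _|a0|a0].
- by rewrite mul0r => /esym/normr0P; rewrite (negbTE b0).
- by case: e => //; rewrite expr1; lra.
- by case: e => //; rewrite expr0; lra.
Qed.

(** Each of the three criteria passes to a point of the closed cell: zero coordinates, weak signs
    and top coordinates persist. *)
Lemma bisector_part_cell (R : realType) d (a b : 'rV[R]_d) (F G : set 'rV[R]_d)
  :
  cell a b -> facet (@cube R d) F -> facet (@cube R d) G ->
  bisector_part F G 0 a !=set0 -> bisector_part F G 0 b !=set0.
Proof.
have [d0|d0] := posnP d.
  by move: a b F G; rewrite d0 => a b F G; rewrite (thinmx0 a) (thinmx0 b).
move=> ab /(facet_cubeP _ d0) [i [e ->]] /(facet_cubeP _ d0) [j [e' ->]].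
have [<-|ij] := eqVneq i j.
  have [<-|/negPf ee'] := eqVneq e e'.
    rewrite !bisector_part_same => ai; have := ab.1 i.
    by rewrite ai sgr0 mul0r => /esym/normr0P/eqP.
  have -> : e' = ~~ e by move: ee'; case: (e); case: (e').
  rewrite !bisector_part_opposite => ai.
  rewrite (signs_agree_mul ab.1); last exact: le_trans ai.
  by apply: ab.2; apply: le_trans ai _; rewrite -(normrMsign e) ler_norm.
rewrite !bisector_part_distinct // => -[ai aj].
split; first by rewrite (signs_agree_mul ab.1).
rewrite -oppr_ge0 -mulNr -signrN (signs_agree_mul ab.1) //.
by rewrite signrN mulNr oppr_ge0.
Qed.

Lemma bisector_equiv_cell (R : realType) d (a b : 'rV[R]_d) :
  cell a b -> cell b a -> bisector_equiv 0 a 0 b.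
Proof. by move=> ab ba F G fF fG; split; apply: bisector_part_cell. Qed.

(** * General position *)

(** Only uniqueness of the top coordinate is asked, so that the origin is generic in dimension 0. *)
Definition generic (R : realType) d (y : 'rV[R]_d) : Prop :=
  (forall k, y 0 k != 0) /\
  (forall i j, `|y| <= `|y 0 i| -> `|y| <= `|y 0 j| -> i = j).

Lemma generic_cell (R : realType) d (a y : 'rV[R]_d) :
  generic a -> cell y a -> generic y.
Proof.
move=> [a0 a1] [s t]; split=> [k|i j yi yj]; last by apply: a1; exact: t.
apply/eqP => yk; have := s k.
by rewrite yk sgr0 mul0r => /esym/normr0P; rewrite (negbTE (a0 k)).
Qed.

(** A nonzero a_k fixes the sign of y_k, and a top coordinate of [y] is one of [a], hence the only
    one. *)
Lemma generic_cell_sym (R : realType) d (a y : 'rV[R]_d) :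
  generic a -> cell y a -> cell a y.
Proof.
move=> [a0 a1] [s t]; split=> [k|k ak].
  by rewrite -(sg_mul_norm_eq (a0 k) (s k)) -normrEsg.
have [j yj] := norm_row_attained y (ord_dim_gt0 k).
by rewrite (a1 k j ak) ?yj // t // yj.
Qed.

Lemma near_dist_lt (R : realType) d (x : 'rV[R]_d) (e : R) : 0 < e ->
  \forall y \near nbhs x, `|x - y| < e.
Proof. by move=> e0; rewrite -nbhs_nbhs_norm; exists e. Qed.

Lemma generic_near_cell (R : realType) d (c : 'rV[R]_d) :
  generic c -> \forall c' \near nbhs c, cell c c' /\ cell c' c.
Proof.
move=> [c0 c1].
have near1 : \forall c' \near nbhs c, forall k, Num.sg ((c' : 'rV[R]_d) 0 k) =
  Num.sg (c 0 k).
  apply: filter_forall => k.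
  have ck : 0 < `|c 0 k| by rewrite normr_gt0.
  near=> c'.
  have : `|(c - c') 0 k| < `|c 0 k|.
    by apply: le_lt_trans (coord_le_norm _ _) _; near: c'; exact: near_dist_lt.
  rewrite !mxE; case: (sgrP (c 0 k)) (c0 k) => [|ck'|ck'] //;
    rewrite ltr_norml => _ /andP[? ?].
    by apply: gtr0_sg; lra.
  by apply: ltr0_sg; lra.
have near2 : \forall c' \near nbhs c, forall p : 'I_d * 'I_d,
    `|c 0 p.1| < `|c 0 p.2| ->
    `|(c' : 'rV[R]_d) 0 p.1| < `|c' 0 p.2|.
  apply: filter_forall => -[i j] /=.
  have [ij|ij] := ltP `|c 0 i| `|c 0 j|; last by near=> c'.
  near=> c' => _.
  (* Moduli that change by less than half their gap keep their order. *)
  have dist k : `|(c - c') 0 k| < (`|c 0 j| - `|c 0 i|) / 2.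
    apply: le_lt_trans (coord_le_norm _ _) _; near: c'; apply: near_dist_lt.
    by rewrite divr_gt0 // subr_gt0.
  have := dist i; have := dist j; rewrite !mxE.
  have := ler_dist_dist (c 0 j) (c' 0 j);
    have := ler_dist_dist (c 0 i) (c' 0 i).
  rewrite !ler_norml => /andP[? ?] /andP[? ?]; lra.
suff : \forall c' \near nbhs c, cell c' c.
  apply: filterS => c' c'c; split=> //.
  exact: generic_cell_sym.
near=> c'.
have s k : Num.sg (c' 0 k) = Num.sg (c 0 k) by move: k; near: c'.
have t : forall p : 'I_d * 'I_d, `|c 0 p.1| < `|c 0 p.2| ->
  `|c' 0 p.1| < `|c' 0 p.2|.
  by near: c'.
split=> [k|i c'i]; first by rewrite s -normrEsg.
have [j cj] := norm_row_attained c (ord_dim_gt0 i).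
rewrite cj leNgt; apply/negP => /(t (i, j)) /=.
by apply/negP; rewrite -leNgt (le_trans (coord_le_norm _ _)).
Unshelve. all: by end_near.
Qed.

Lemma generic_general_position (R : realType) d (c : 'rV[R]_d) :
  generic c -> general_position c.
Proof.
move=> /generic_near_cell; apply: filterS => c' [cc' c'c].
exact: bisector_equiv_cell.
Qed.

Lemma generic_interior_cell (R : realType) d (c : 'rV[R]_d) :
  generic c -> interior (cell c) c.
Proof. by move=> /generic_near_cell; apply: filterS => c' []. Qed.

Lemma near_ray (R : realType) d (c v : 'rV[R]_d) (P : set 'rV[R]_d) :
  (\forall x \near nbhs c, P x) -> exists2 e : R, 0 < e & P (c + e *: v).
Proof.
rewrite -nbhs_nbhs_norm => -[r /= r0 rP].
have v0 : 0 < `|v| + 1 by rewrite ltr_wpDl.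
exists (r / (`|v| + 1)); first by rewrite divr_gt0.
apply: rP; rewrite /ball_ /= opprD addNKr normrN normrZ ger0_norm.
  by rewrite -mulrA gtr_pMr // mulrC ltr_pdivrMr // mul1r ltrDl.
by rewrite divr_ge0 // ltW.
Qed.

(** A move along one axis destroys each degeneracy: making a zero coordinate nonzero empties a part
    with F = G; if |c| is attained at both i and j, shrinking |c_i| leaves the norm at least |c_j|
    and empties a part with G = -F. *)
Lemma general_position_generic (R : realType) d (c : 'rV[R]_d) :
  general_position c -> generic c.
Proof.
move=> gp; have fac (i : 'I_d) b : facet (@cube R d) (signed_facet R i b).
  apply/facet_cubeP; last by exists i, b.
  exact: ord_dim_gt0 i.
split=> [i|i j ci cj].
  apply/eqP => ci; have [e e0 ce] := near_ray (delta_mx 0 i) gp.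
  have /bisector_part_same := (ce _ _ (fac i true) (fac i true)).1
    ((bisector_part_same i true c).2 ci).
  by rewrite !mxE !eqxx ci add0r mulr1 => e0'; rewrite e0' ltxx in e0.
apply/eqP/negPn/negP => ij; pose b := c 0 i < 0.
have bci : (-1) ^+ b * c 0 i = `|c 0 i| by rewrite -normrEsign.
have ci' : `|c| <= (-1) ^+ b * c 0 i by rewrite bci.
have [e e0 ce] := near_ray (- (-1) ^+ b *: delta_mx 0 i) gp.
have /bisector_part_opposite := (ce _ _ (fac i b) (fac i (~~ b))).1
    ((bisector_part_opposite i b c).2 ci').
rewrite -/b; set s := (-1) ^+ b in bci *;
  have ss : s * s = 1 by rewrite -expr2 sqrr_sign.
rewrite !mxE !eqxx mulr1 mulrDr bci 2!mulrN mulrCA ss mulr1 => c'i.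
have := coord_le_norm (c + e *: (- s *: delta_mx 0 i)) j.
rewrite !mxE eqxx /= eq_sym (negbTE ij) !mulr0 addr0 => c'j.
have := coord_le_norm c i; lra.
Qed.

Lemma generic_above (R : realType) d (y : 'rV[R]_d) :
  exists2 a, generic a & cell a y.
Proof.
have [d0|d0] := posnP d.
  exists y; last exact: cell_refl.
  have no_ord (k : 'I_d) : False by have := ord_dim_gt0 k; rewrite d0.
  by split=> k; case: (no_ord k).
have [i yi] := norm_row_attained y d0.
pose s k : R := (-1) ^+ (y 0 k < 0)%R.
(* Zero coordinates of [y] become positive, and one coordinate attaining |y| gets modulus 2 against
   1 elsewhere. *)
pose a : 'rV[R]_d := \row_k (s k * (1 + (k == i)%:R)).
have aE k : `|a 0 k| = 1 + (k == i)%:R.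
  by rewrite mxE normrMsign ger0_norm // addr_ge0.
have top k : `|a| <= `|a 0 k| -> k = i.
  move=> ak; have := le_trans (coord_le_norm a i) ak.
  by rewrite !aE eqxx; case: eqP => // _; rewrite lerD2l ler10.
exists a; first split=> [k|j k /top -> /top ->] //.
  by rewrite -normr_gt0 aE ltr_wpDr.
split=> [k|k /top ->]; last by rewrite yi.
have sgs : Num.sg (s k) = s k.
  by rewrite /s; case: (y 0 k < 0); rewrite ?expr0 ?expr1 ?sgrN1 ?sgr1.
rewrite mxE sgrM sgs (gtr0_sg (_ : 0 < 1 + _)) ?mulr1 ?ltr_wpDr //.
by rewrite normrEsign.
Qed.

Lemma generic_spread (R : realType) d (a : 'rV[R]_d) : generic a ->
  exists b, [/\ generic b, cell a b &
    forall i j, i != j -> `|b 0 i| != `|b 0 j|].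
Proof.
move=> ga; have [d0|d0] := posnP d.
  exists a; split=> //; first exact: cell_refl.
  have no_ord (k : 'I_d) : False by have := ord_dim_gt0 k; rewrite d0.
  by move=> k; case: (no_ord k).
have [i ai] := norm_row_attained a d0.
(* The moduli are k + 1 <= d off the top index and d + 1 at it, hence distinct and largest at
   [i]. *)
pose b : 'rV[R]_d :=
  \row_k (Num.sg (a 0 k) * (if k == i then d.+1 else k.+1)%:R).
have bE k : `|b 0 k| = (if k == i then d.+1 else k.+1)%:R.
  by rewrite mxE normrM normr_sg ga.1 mul1r normr_nat.
have top k : `|b| <= `|b 0 k| -> k = i.
  move=> bk; have := le_trans (coord_le_norm b i) bk.
  rewrite !bE eqxx; case: eqP => // _; rewrite ler_nat ltnS.
  by rewrite leqNgt ltn_ord.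
exists b; split.
- split=> [k|j k /top -> /top ->] //.
  by rewrite -normr_gt0 bE ltr0n; case: ifP.
- split=> [k|k ak].
    by rewrite -[LHS]ger0_norm mxE ?normrM ?normr_sg ?ga.1 ?mul1r // mulrA
      -expr2 sqr_sg ga.1 mul1r.
  have -> : k = i by apply: ga.2 => //; rewrite ai.
  rewrite bE eqxx; apply: norm_row_le => // j; rewrite bE ler_nat.
  by case: ifP => // _; rewrite ltnS ltnW // ltn_ord.
move=> j k jk; rewrite !bE eqr_nat.
have [ji|_] := eqVneq j i; have [ki|_] := eqVneq k i.
- by rewrite ji ki eqxx in jk.
- by rewrite eqSS gtn_eqF // ltn_ord.
- by rewrite eqSS ltn_eqF // ltn_ord.
- by rewrite eqSS.
Qed.

Lemma near_affine_neq0 (R : realType) (p q : R) : q != 0 ->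
  \forall t \near 0^'+, p + t * q != 0.
Proof.
move=> q0; have root t : p + t * q = 0 -> t = - p / q.
  by move=> /eqP; rewrite addr_eq0 => /eqP ->; rewrite opprK mulfK.
have [r0|r0] := leP (- p / q) 0.
  near=> t; apply/eqP => /root tr.
  by have : 0 < t; [near: t; exact: nbhs_right_gt|rewrite tr ltNge r0].
near=> t; apply/eqP => /root tr.
by have : t < - p / q; [near: t; exact: nbhs_right_lt|rewrite tr ltxx].
Unshelve. all: by end_near.
Qed.

(** Zero coordinates and coinciding moduli occur only at roots of x_k + t b_k and of (x_i ± x_j) + t
    (b_i ± b_j), which are nonconstant by the hypotheses on [b]. *)
Lemma generic_near_ray (R : realType) d (x b : 'rV[R]_d) : generic b ->
  (forall i j, i != j -> `|b 0 i| != `|b 0 j|) ->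
  \forall t \near 0^'+, generic (x + t *: b).
Proof.
move=> [b0 _] bij.
have near_nz : \forall t \near 0^'+, forall k, (x + t *: b) 0 k != 0.
  apply: filter_forall => k; apply: filterS (near_affine_neq0 (x 0 k) (b0 k)).
  by move=> t; rewrite !mxE.
have near_nd : \forall t \near 0^'+, forall p : 'I_d * 'I_d, p.1 != p.2 ->
    `|(x + t *: b) 0 p.1| != `|(x + t *: b) 0 p.2|.
  apply: filter_forall => -[i j] /=.
  have [->|ij] := eqVneq i j; first exact: filterE.
  have := bij i j ij; rewrite eqr_norm2 negb_or -subr_eq0 -addr_eq0 =>
    /andP[bB bD].
  apply: filterS2 (near_affine_neq0 (x 0 i - x 0 j) bB)
    (near_affine_neq0 (x 0 i + x 0 j) bD) => t tB tD _.
  rewrite eqr_norm2 negb_or -subr_eq0 -addr_eq0 !mxE.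
  rewrite opprD addrACA -mulrBr tB /=.
  by rewrite addrACA -mulrDr.
apply: filterS2 near_nz near_nd => t nz nd.
split=> // i j ti tj; apply/eqP/negPn/negP => ij.
have /negP := nd (i, j) ij; apply; rewrite eq_le /=.
rewrite (le_trans (coord_le_norm _ _) tj).
exact: le_trans (coord_le_norm _ _) ti.
Qed.

(** Opposite facets reveal the top coordinate and its sign; pairing the top facet with a facet of
    another axis [k] reveals the sign of coordinate [k]. *)
Lemma bisector_equiv_generic (R : realType) d (a b : 'rV[R]_d) :
  generic a -> generic b -> bisector_equiv 0 a 0 b -> cell a b.
Proof.
move=> ga gb ab; apply: generic_cell_sym => //.
have fac (i : 'I_d) e : facet (@cube R d) (signed_facet R i e).
  apply/facet_cubeP; last by exists i, e.
  exact: ord_dim_gt0 i.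
have sgn (c : 'rV[R]_d) k : (-1) ^+ (c 0 k < 0)%R * c 0 k = `|c 0 k|.
  by rewrite -normrEsign.
have top i : `|a| <= `|a 0 i| ->
    `|b| <= (-1) ^+ (a 0 i < 0)%R * b 0 i.
  move=> ai; apply/bisector_part_opposite/(ab _ _ (fac _ _) (fac _ _)).
  by apply/bisector_part_opposite; rewrite sgn.
have sign_b i k : `|a| <= `|a 0 i| -> (-1) ^+ (a 0 k < 0)%R * b 0 k >= 0.
  move=> ai; have [<-|ik] := eqVneq i k.
    exact: le_trans (top i ai).
  have /(bisector_part_distinct _ _ _ ik)[] // : bisector_part
      (signed_facet R i (a 0 i < 0)) (signed_facet R k (~~ (a 0 k < 0))) 0 b
      !=set0.
    apply/(ab _ _ (fac _ _) (fac _ _))/bisector_part_distinct => //.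
    by rewrite signrN mulNr !sgn oppr_le0.
  by rewrite signrN mulNr oppr_le0.
split=> [k|i bi].
  have [i ai] := norm_row_attained a (ord_dim_gt0 k).
  have {}ai : `|a| <= `|a 0 i| by rewrite ai.
  have := sign_b i k ai; have := gb.1 k; have := ga.1 k.
  rewrite normrEsign; case: (sgrP (b 0 k)) => // bk _ _.
    by rewrite mul1r; case: (a 0 k < 0); rewrite ?expr0 ?expr1; lra.
  by rewrite mulN1r; case: (a 0 k < 0); rewrite ?expr0 ?expr1; lra.
have [j aj] := norm_row_attained a (ord_dim_gt0 i).
have {}aj : `|a| <= `|a 0 j| by rewrite aj.
rewrite (gb.2 i j bi) //; apply: le_trans (top j aj) _.
by rewrite -(normrMsign (a 0 j < 0)%R) ler_norm.
Qed.

Lemma cell_fan_bisection (R : realType) d :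
  is_cube_bisection_fan (@cell_fan R d).
Proof.
split=> [|a b /general_position_generic ga /general_position_generic gb].
  exact: cell_fan_polyhedral.
split=> [ab|[_ [[[y _ <-] _] /interior_subset ya /interior_subset yb]]].
  have cab := bisector_equiv_generic ga gb ab.
  exists (cell a); split; last 2 first.
  - exact: generic_interior_cell.
  - have := generic_interior_cell gb; apply: interiorS => x.
    exact: cell_trans.
  split=> [|_ [y _ <-] ay]; first by exists a.
  have ya := ay _ (cell_refl a); rewrite eqEsubset; split=> // x.
  by apply: cell_trans; exact: generic_cell_sym.
have ay := generic_cell_sym ga ya; have b_y := generic_cell_sym gb yb.
by apply: bisector_equiv_cell; [exact: cell_trans yb|exact: cell_trans ya].
Qed.

(** * Uniqueness of the bisection fan *)

(** A small step from [a] along the normal [u] stays in [C], which forces u.u <= 0, so [u = 0]. *)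
Lemma face_interior (R : realType) d (C F : set 'rV[R]_d) a :
  face C F -> interior C a -> F a -> F = C.
Proof.
move=> [u [c [uc ->]]] Ca [_ /= ua].
have [e e0 Cae] := near_ray u Ca.
have := uc _ Cae; rewrite dotvD dotvZ ua gerDl pmulr_rle0 // => uu.
have u0 : u = 0.
  have sq k : true -> 0 <= u 0 k * u 0 k by rewrite -expr2 sqr_ge0.
  have uu0 : dotv u u = 0 by apply/le_anti; rewrite uu sumr_ge0.
  apply/rowP => k; rewrite [RHS]mxE;
    have /eqP := @psumr_eq0P _ _ _ _ sq uu0 k isT.
  by rewrite mulf_eq0 orbb => /eqP.
rewrite eqEsubset; split=> [x []//|x Cx]; split=> //=.
by rewrite -ua u0 !dotv0l.
Qed.

(** The intersection is a face of both cones through a point interior to each, hence equals both. *)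
Lemma fan_interior_unique (R : realType) d (D : set (set 'rV[R]_d)) C C' a :
  polyhedral_fan D -> D C -> D C' -> interior C a -> interior C' a -> C = C'.
Proof.
move=> [_ _ _ inter] DC DC' Ca C'a; have [fC fC'] := inter _ _ DC DC'.
have CC'a : (C `&` C') a by split; exact: interior_subset.
by rewrite -(face_interior fC Ca CC'a) -{2}(face_interior fC' C'a CC'a).
Qed.

(** Points near [x + t *: b] have the form [x + t *: b'] with [b'] near [b]. *)
Lemma interior_cone_add (R : realType) d (C : set 'rV[R]_d) x b (t : R) :
  polyhedral_cone C -> C x -> interior C b -> 0 < t -> interior C (x + t *: b).
Proof.
move=> [n [u CE]] Cx + t0; rewrite /interior -!nbhs_nbhs_norm => -[e /= e0 eC].
exists (t * e) => /=; first exact: mulr_gt0.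
move=> y /= yt; have : C (t^-1 *: (y - x)).
  apply: eC; rewrite /ball_ /= -(ltr_pM2l t0) -[X in X * `|_|]gtr0_norm //.
  rewrite -normrZ scalerBr scalerA mulfV ?gt_eqF // scale1r opprB addrA.
  by rewrite (addrC (t *: b)).
move: Cx; rewrite CE => /= Cx + k => /(_ k); rewrite dotvZ dotvB.
rewrite pmulr_rge0 ?invr_gt0 // subr_ge0; exact: le_trans.
Qed.

(** Passage to the limit t -> 0 in a linear inequality along a ray. *)
Lemma near_affine_ge0 (R : realType) (p q : R) :
  (\forall t \near 0^'+, 0 <= p + t * q) -> 0 <= p.
Proof.
move=> h; rewrite leNgt; apply/negP => p0.
have q0 : 0 < `|q| + 1 by rewrite ltr_wpDl.
suff : \forall t \near (0 : R)^'+, False by move=> /filter_ex [].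
have tp := @nbhs_right_lt R 0 (- p / (`|q| + 1)).
apply: filterS3 h (tp _) (nbhs_right_gt (0 : R)) => [t pt tlt t0|]; last first.
  by rewrite divr_gt0 // oppr_gt0.
move: tlt; rewrite ltr_pdivlMr // => tlt.
have : t * q <= t * `|q| by rewrite ler_pM2l // ler_norm.
lra.
Qed.

Lemma polyhedral_cone0 (R : realType) d (C : set 'rV[R]_d) :
  polyhedral_cone C -> C 0.
Proof. by move=> [n [u ->]] k; rewrite dotv0. Qed.

Lemma polyhedral_coneD (R : realType) d (C : set 'rV[R]_d) x y :
  polyhedral_cone C -> C x -> C y -> C (x + y).
Proof.
by move=> [n [u ->]] Cx Cy k; rewrite dotvD addr_ge0 ?Cx ?Cy.
Qed.

Lemma polyhedral_coneZ (R : realType) d (C : set 'rV[R]_d) (a : R) x :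
  polyhedral_cone C -> 0 <= a -> C x -> C (a *: x).
Proof. by move=> [n [u ->]] a0 Cx k; rewrite dotvZ mulr_ge0 ?Cx. Qed.

Lemma bisection_fan_generic_cell (R : realType) d (D : set (set 'rV[R]_d)) a :
  is_cube_bisection_fan D -> generic a -> D (cell a).
Proof.
move=> [fanD bisD] ga; have gpa := generic_general_position ga.
have [C [maxC Ca _]] := (bisD a a gpa gpa).1 (fun F G _ _ => iff_refl _).
have DC := maxC.1; have polyC : polyhedral_cone C by case: fanD => _ + _ _;
  exact.
suff <- : C = cell a by [].
(* The maximal cone supplied for [a] and [b] shares the interior point [a] with [C], so it is
   [C]. *)
have Cint b : generic b -> cell a b -> interior C b.
  move=> gb ab; have gpb := generic_general_position gb.
  have ba := generic_cell_sym gb ab.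
  have [C' [[DC' _] C'a C'b]] :=
    (bisD a b gpa gpb).1 (bisector_equiv_cell ab ba).
  by rewrite (fan_interior_unique fanD DC DC' Ca C'a).
rewrite eqEsubset; split=> x.
- move=> Cx; have [b [gb ab b_neq]] := generic_spread ga.
  have near_cell : \forall t \near 0^'+, cell a (x + t *: b).
    apply: filterS2 (generic_near_ray x gb b_neq) (nbhs_right_gt (0 : R)) =>
      t gt t0.
    apply: bisector_equiv_generic => //.
    apply/(bisD _ _ gpa (generic_general_position gt)).
    by exists C; split=> //; apply: interior_cone_add => //; exact: Cint.
  apply/cell_ineqP => p; apply: (@near_affine_ge0 _ _ (dotv (cell_ineq a p) b)).
  by apply: filterS near_cell => t /cell_ineqP/(_ p); rewrite dotvD dotvZ.
- move=> ax; case: (polyC) => n [u CE]; rewrite CE => k.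
  apply: (@near_affine_ge0 _ _ (dotv (u k) a)).
  apply: filterS (nbhs_right_gt (0 : R)) => t t0.
  have ata : cell a (t *: a) by apply: cellZ (ltW t0) (cell_refl a).
  suff : C (x + t *: a) by rewrite CE => /(_ k); rewrite dotvD dotvZ.
  apply: interior_subset; apply: Cint; last exact: cellD.
  (* [a] is a multiple of the summand [t *: a], so it lies in the cell of the sum, which is
     therefore generic. *)
  apply: generic_cell ga _; rewrite addrC.
  apply: cell_trans (cell_addl_cell ata ax) _.
  rewrite -{2}(scale1r a) -(mulVf (lt0r_neq0 t0)) -scalerA.
  by apply: cellZ (cell_refl _); rewrite invr_ge0 ltW.
Qed.

Lemma bisection_fan_unique (R : realType) d (D : set (set 'rV[R]_d)) :
  is_cube_bisection_fan D -> D = @cell_fan R d.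
Proof.
move=> bisD; have Dgen := bisection_fan_generic_cell bisD.
have [_ polyD faceD interD] := bisD.1; rewrite eqEsubset; split=> C; last first.
  move=> [y _ <-]; have [a ga ay] := generic_above y.
  apply: faceD (Dgen _ ga) (face_cell ay) _; exists 0; exact: cell0.
move=> DC; have polyC := polyD _ DC.
have C0 := polyhedral_cone0 polyC.
have [z Cz zdom] := exists_dominating C0 (fun x w =>
  @polyhedral_coneD _ _ _ x w polyC).
have [a ga az] := generic_above z.
have [fC fa] := interD _ _ DC (Dgen _ ga).
suff Ca : C `<=` cell a.
  (* [C] is now itself the intersection, hence a face of [cell a]. *)
  rewrite (setIidl Ca) in fa; have [|y ->] := face_cell_is_cell fa;
    last by exists y.
  by exists 0.
have [||u uC faceE] := face_cone C0 _ fC.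
- by move=> t x; exact: polyhedral_coneZ.
- by exists z.
move=> x /zdom [x' [w [Cx' Cw xx' zE]]].
suff : (C `&` cell a) x' by move=> [_ ax']; exact: cell_trans xx'.
rewrite faceE; split=> //=.
have : (C `&` cell a) z by [].
(* [u] is nonpositive at both summands of [z] and vanishes at [z], so it vanishes at [x']. *)
rewrite faceE => -[_ /=]; rewrite zE dotvD => uxw.
have := uC _ Cx'; have := uC _ Cw; lra.
Qed.

Theorem theorem5p2 (R : realType) (d : nat) :
  is_cube_bisection_fan
    (common_refinement (@coordinate_fan R d) (face_fan (@cube R d))) /\
  (forall D : set (set 'rV[R]_d), is_cube_bisection_fan D ->
     D = common_refinement (@coordinate_fan R d) (face_fan (@cube R d))).
Proof.
rewrite common_refinementE; split; first exact: cell_fan_bisection.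
by move=> D; exact: bisection_fan_unique.
Qed.
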